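(* Let $p(u\mid\vartheta)=h(u)\exp(u\vartheta-A(\vartheta))$ be a regular one-parameter exponential family with natural statistic $T(u)=u$, and let $\eta$ be a link function. Fix a group size $n\ge 1$, covariates $x=(x_1,\dots,x_n)\in(\mathbb{R}^p)^n$ and $\mathrm{z}\in\mathbb{R}^q$, and parameters $(\theta,\psi)$ with associated functions $f_\theta:\mathbb{R}^p\to\mathbb{R}$ and $g_\psi:\mathbb{R}^q\to\mathbb{R}^k$. For $y=(y_1,\dots,y_n)\in\operatorname{supp}(h)^n$ and $\xi\in\mathbb{R}$ define $$\vartheta_i(\xi)=(A')^{-1}\Bigl(\eta^{-1}\bigl(f_\theta(x_i)+\Vert g_\psi(\mathrm{z})\Vert\,\xi\bigr)\Bigr),\qquad L(\xi;y)=\sum_{i=1}^{n}\bigl[y_i\,\vartheta_i(\xi)-A(\vartheta_i(\xi))\bigr]+\log\phi_1(\xi),$$ $$I(y)=\int_{\mathbb{R}}\exp\bigl(L(\xi;y)\bigr)\,d\xi,\qquad I_M(y)=\int_{-M}^{M}\exp\bigl(L(\xi;y)\bigr)\,d\xi,\qquad \Delta_M(y)=\log I(y)-\log I_M(y)\quad(M>0).$$ Then for all $y\in\operatorname{supp}(h)^n$ there exist constants $M_0>0$ and $C>0$ (which may depend on $y,x,\mathrm{z},\theta,\psi$) such that for all $M\ge M_0$, $$0\le\Delta_M(y)\le C\,\frac{1}{M}\exp\Bigl(-\tfrac12 M^2\Bigr),$$ and therefore $$\limsup_{M\to\infty}\frac{1}{M^2}\log\Delta_M(y)\le-\frac12 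.$$
   Context: $\phi_1(\xi)=(2\pi)^{-1/2}e^{-\xi^2/2}$ is the standard Gaussian density on $\mathbb{R}$, and $\Vert\cdot\Vert$ is the Euclidean norm. The exponential family lives on a response space $\mathcal{Y}\subseteq\mathbb{R}$; $h\ge 0$ is the base measure (a density with respect to Lebesgue measure, or a mass function if $\mathcal{Y}$ is discrete), $\operatorname{supp}(h)$ is its support, and $A(t)=\log\int h(u)e^{ut}\,du$ is the log-partition function (the integral being a sum when $\mathcal{Y}$ is discrete). ''Regular'' has its usual meaning: the natural parameter space $\{t: A(t)<\infty\}$ is a nonempty open set and the family is non-degenerate, so that $A'$ is strictly increasing, hence invertible onto its range, and $A'(\vartheta)$ is the mean of $p(\cdot\mid\vartheta)$. A link function $\eta$ is a fixed continuous, strictly monotone function on the set of means whose inverse $\eta^{-1}$ is defined on all of $\mathbb{R}$ and takes values in the range of $A'$; it need not be canonical (the canonical link is $\eta=(A')^{-1}$). $f_\theta$ and $g_\psi$ (neural networks in the application) are just fixed functions here. By convention $\log 0=-\infty$.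
   Formalization: When h is a density, no y_i may be an endpoint of the support (base mass is required strictly on both sides of each y_i); without this the claim fails, e.g. for the exponential distribution with log link, n=1, f=0, ‖g‖=1 and y=0. *)

(* Defs.v *)
From HB Require Import structures.
From mathcomp Require Import all_boot all_order all_algebra.
From mathcomp Require Import all_classical all_reals all_analysis.
Set Implicit Arguments.
Unset Strict Implicit.
Unset Printing Implicit Defensive.
Import Order.TTheory GRing.Theory Num.Theory.
Import numFieldNormedType.Exports.
Local Open Scope classical_set_scope.
Local Open Scope ring_scope.

Variant dominating := Lebesgue | Counting.

(* An integral against [counting] over a countable response space is a sum. *)
Definition dominating_measure (R : realType) (d : dominating) :
    {measure set (measurableTypeR R) -> \bar R} :=
  match d with
  | Lebesgue => @lebesgue_measure R
  | Counting => @counting (measurableTypeR R) R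
  end.

(* [base] is only relevant on [response]; for a countable response space the
   two measurability fields hold automatically. *)
Record expfam (R : realType) := Expfam {
  dom : dominating;
  response : set (measurableTypeR R);
  base : measurableTypeR R -> R;
  measurable_response : measurable response;
  countable_response : dom = Counting -> countable response;
  measurable_base : measurable_fun response base;
  base_ge0 : forall u, response u -> 0 <= base u }.

Section expfam_theory.
Variables (R : realType) (E : expfam R).

Definition ref_measure := dominating_measure R (dom E).

Definition base_mass (B : set (measurableTypeR R)) : \bar R :=
  (\int[ref_measure]_(u in response E `&` B) (base E u)%:E)%E.

Definition log_partition (t : R) : \bar R :=
  lne (\int[ref_measure]_(u in response E) (base E u * expR (u * t))%:E)%E.

Definition natural_space : set R := [set t | (log_partition t < +oo)%E].

Definition A (t : R) : R := fine (log_partition t).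

Definition mean_space : set R := derive1 A @` natural_space.

(* Partial inverse on [natural_space]; meaningful on [mean_space]. *)
Definition A'_inv : R -> R := 'pinv_(fun=> 0) natural_space (derive1 A).

(* Neither the zero measure nor concentrated at a single point. *)
Definition nondegenerate_base : Prop :=
  ~ exists c : R, {ae ref_measure, forall u, response E u -> u <> c -> base E u = 0}.

Definition regular : Prop :=
  [/\ natural_space !=set0, open natural_space & nondegenerate_base].

(* A density is supported on the closure of the set where it is positive; a
   mass function on the set of its atoms. *)
Definition supp : set R :=
  match dom E with
  | Lebesgue => closure [set u : R | response E u /\ 0 < base E u]
  | Counting => [set u : R | response E u /\ 0 < base E u]
  end.

(* No base mass strictly on one side of u.  If the base measure has a density,
   t |-> u * t - A t is unbounded above at such a u.  For instance, with the
   density 1 on [0, +oo[, A t = - ln (- t), the link ln, u = 0 and n = 1, the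
   integrand of the marginal likelihood is expR (- xi) times the standard
   normal density, and the mass it leaves outside [- M, M] is not
   O(M^-1 * expR (- M ^+ 2 / 2)). *)
Definition support_endpoint (u : R) : Prop :=
  base_mass `]-oo, u[ = 0%E \/ base_mass `]u, +oo[ = 0%E.

(* Surjectivity onto R says that the inverse of the link is defined on all of R
   with values in the range of the derivative of A. *)
Definition link_function (eta : R -> R) : Prop :=
  [/\ {within mean_space, continuous eta},
      {in mean_space &, {homo eta : a b / a < b}} \/
      {in mean_space &, {homo eta : a b /~ a < b}} &
      set_surj mean_space setT eta].

Definition link_inv (eta : R -> R) : R -> R := 'pinv_(fun=> 0) mean_space eta.

End expfam_theory.

(* The norm [`|v|] of the library on row vectors is the sup norm. *)
Definition euclidean_norm (R : realType) (k : nat) (v : 'rV[R]_k) : R :=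
  Num.sqrt (\sum_(j < k) v ord0 j ^+ 2).

Definition phi1 (R : realType) : R -> R := normal_pdf 0 1.

Section marginal_likelihood.
Variables (R : realType) (E : expfam R) (eta : R -> R).
Variables (n p q k : nat) (f : 'rV[R]_p -> R) (g : 'rV[R]_q -> 'rV[R]_k).
Variables (x : 'I_n -> 'rV[R]_p) (z : 'rV[R]_q) (y : 'I_n -> R).

Definition vartheta (i : 'I_n) (xi : R) : R :=
  A'_inv E (link_inv E eta (f (x i) + euclidean_norm (g z) * xi)).

Definition L (xi : R) : R :=
  \sum_(i < n) (y i * vartheta i xi - A E (vartheta i xi)) + ln (phi1 xi).

Definition I_full : \bar R :=
  (\int[@lebesgue_measure R]_xi (expR (L xi))%:E)%E.

Definition I_trunc (M : R) : \bar R :=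
  (\int[@lebesgue_measure R]_(xi in `[(- M)%R, M]) (expR (L xi))%:E)%E.

Definition Delta (M : R) : \bar R := (lne I_full - lne (I_trunc M))%E.

End marginal_likelihood.

(* Main.v *)
(* For [y] in the support, the exponential tilts of the base measure give
   [Z(t) >= c * expR (y * t)] with [c > 0], so that [y * t - A(t)] is bounded
   above on the natural parameter space and the integrand is at most a constant
   times the Gaussian density.  The mass it leaves outside [- M, M] is then
   controlled by Mills' bound, and [ln (1 + r) <= r] converts relative mass into
   a difference of logarithms.  The integrand must be measurable for this mass
   to be the difference of the two integrals: [A'] is nondecreasing by Jensen's
   inequality, hence [A'_inv] and [link_inv] are monotone on their domains, and
   so is each [vartheta i]. *)

Require Import Defs.
From HB Require Import structures.
From mathcomp Require Import all_boot all_order all_algebra.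
From mathcomp Require Import all_classical all_reals all_analysis.
From mathcomp Require Import measurable_realfun ring lra.
Set Implicit Arguments.
Unset Strict Implicit.
Unset Printing Implicit Defensive.
Import Order.TTheory GRing.Theory Num.Theory.
Import numFieldNormedType.Exports.
Local Open Scope classical_set_scope.
Local Open Scope ring_scope.

(** * Laplace transform of a measure: derivative and tangent bound *)

Section laplace_transform.
Variables (R : realType) (mu : {measure set (measurableTypeR R) -> \bar R}).
Variables (D : set (measurableTypeR R)) (h : measurableTypeR R -> R).
Hypotheses (mD : measurable D) (mh : measurable_fun D h).
Hypothesis h_ge0 : forall u, D u -> 0 <= h u.

Definition tilt (t u : R) : R := h u * expR (u * t).

Definition finite_at : set R := [set t | (\int[mu]_(u in D) (tilt t u)%:E < +oo)%E].

(** An infinite integral is sent to 0, so the value has meaning only on [finite_at]. *)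
Definition laplace (t : R) : R := \int[mu]_(u in D) tilt t u.

Lemma measurable_tilt t : measurable_fun D (tilt t).
Proof.
apply: measurable_funM => //; apply: measurableT_comp => //.
by apply: measurable_funM.
Qed.

Lemma tilt_ge0 t u : D u -> 0 <= tilt t u.
Proof. by move=> Du; rewrite mulr_ge0 ?expR_ge0 ?h_ge0. Qed.

Lemma integrable_tilt t : finite_at t -> mu.-integrable D (EFin \o tilt t).
Proof.
move=> tfin; apply/integrableP; split.
  by apply/measurable_EFinP; exact: measurable_tilt.
rewrite (le_lt_trans _ tfin)// le_eqVlt; apply/orP; left; apply/eqP.
by apply: eq_integral => u /set_mem Du; rewrite /= ger0_norm// tilt_ge0.
Qed.

Lemma laplaceE t : finite_at t ->
  (\int[mu]_(u in D) (tilt t u)%:E)%E = (laplace t)%:E.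
Proof.
move=> tfin; rewrite /laplace /Rintegral fineK//.
exact/integrable_fin_num/integrable_tilt.
Qed.

(* |u| is absorbed by |u| d <= expR (|u| d), which costs a second d in the
   exponent. *)
Lemma moment_tilt_le (a d x u : R) : 0 < d -> `|x - a| <= d ->
  `|u * tilt x u| <= d^-1 * (`|tilt (a - 2 * d) u| + `|tilt (a + 2 * d) u|).
Proof.
move=> d0 xa; rewrite /tilt !normrM !(ger0_norm (expR_ge0 _)).
rewrite -mulrDr mulrCA [leRHS]mulrCA ler_wpM2l//.
rewrite [leRHS]mulrC ler_pdivlMr// mulrC mulrA.
apply: (@le_trans _ _ (expR (u * a + 2 * d * `|u|))).
  apply: (@le_trans _ _ (expR (d * `|u|) * expR (u * a + d * `|u|))).
    apply: ler_pM => //; first by rewrite mulr_ge0// ltW.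
      by rewrite (le_trans _ (expR_ge1Dx _))// lerDr.
    rewrite ler_expR -lerBlDl -mulrBr (le_trans (ler_norm _))// normrM.
    by rewrite mulrC ler_wpM2r.
  by rewrite -expRD ler_expR; lra.
(* The sign of [u] decides which of the two end tilts has the exponent [u * a + 2 * d * |u|]. *)
have [u0|u0] := leP 0 u.
  rewrite ger0_norm// -[leLHS]add0r lerD ?expR_ge0// ler_expR; lra.
rewrite ltr0_norm// -[leLHS]addr0 lerD ?expR_ge0// ler_expR; lra.
Qed.

Lemma finite_at_nbhs a : open finite_at -> finite_at a ->
  exists d : R, [/\ 0 < d, finite_at (a - 2 * d), finite_at (a + 2 * d) &
    forall x, `|x - a| <= d -> finite_at x].
Proof.
move=> oN Na; have /nbhs_ballP[e /= e0 He] : nbhs a finite_at by exact: open_nbhs_nbhs.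
(* A third of the radius keeps [a - 2 * d] and [a + 2 * d], the parameters of the dominating tilts
   in [moment_tilt_le], inside the ball. *)
exists (e / 3); split; first by rewrite divr_gt0.
- by apply: He; rewrite /ball/= ltr_norml; apply/andP; split; lra.
- by apply: He; rewrite /ball/= ltr_norml; apply/andP; split; lra.
- by move=> x xa; apply: He; rewrite /ball/= distrC (le_lt_trans xa)//; lra.
Qed.

Lemma integrable_tilt_norms (c s t : R) : finite_at s -> finite_at t ->
  mu.-integrable D (EFin \o (fun u => c * (`|tilt s u| + `|tilt t u|))).
Proof.
move=> /integrable_tilt/integrable_norm is_ /integrable_tilt/integrable_norm it.
exact: (integrableZl mD c (integrableD mD is_ it)).
Qed.

Lemma integrable_moment_tilt a : open finite_at -> finite_at a ->
  mu.-integrable D (EFin \o (fun u => u * tilt a u)).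
Proof.
move=> oN Na; have [d [d0 Nl Nr Nd]] := finite_at_nbhs oN Na.
apply: (le_integrable mD _ _ (integrable_tilt_norms d^-1 Nl Nr)).
- apply/measurable_EFinP; apply: measurable_funM => //; exact: measurable_tilt.
- move=> u Du; rewrite /= lee_fin [leRHS]ger0_norm.
    by rewrite moment_tilt_le// subrr normr0 ltW.
  by rewrite mulr_ge0 ?invr_ge0 ?(ltW d0) ?addr_ge0.
Qed.

Lemma partial1of2_tilt x u : partial1of2 tilt x u = u * tilt x u.
Proof.
rewrite partial1of2E /tilt.
have : is_derive x (1:R) (fun t => h u * expR (u * t)) (u * (h u * expR (u * x))).
  by apply: is_derive_eq; rewrite /GRing.scale/=; ring.
by move=> H; apply: derive_val.
Qed.

Lemma is_derive_laplace a : open finite_at -> finite_at a ->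
  is_derive a (1 : R) laplace (\int[mu]_(u in D) (u * tilt a u)).
Proof.
move=> oN Na; have [d [d0 Nl Nr Nd]] := finite_at_nbhs oN Na.
have Ia : `]a - d, a + d[%classic a by rewrite /= in_itv/=; lra.
have Inorm x : `]a - d, a + d[%classic x -> `|x - a| <= d.
  by rewrite /= in_itv/= => /andP[? ?]; rewrite ler_norml; lra.
have intf x : `]a - d, a + d[%classic x -> mu.-integrable D (EFin \o tilt x).
  by move=> /Inorm xa; exact/integrable_tilt/Nd.
have df x u : `]a - d, a + d[%classic x -> D u -> derivable (tilt ^~ u) x 1.
  by move=> _ _; rewrite /tilt.
(* Free of [x]: one integrable bound on the [x]-derivative over the whole interval. *)
pose G u := d^-1 * (`|tilt (a - 2 * d) u| + `|tilt (a + 2 * d) u|).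
have G_ge0 u : 0 <= G u.
  by rewrite mulr_ge0 ?invr_ge0 ?(ltW d0) ?addr_ge0.
have intG : mu.-integrable D (EFin \o G) by exact: integrable_tilt_norms.
have G_ub x u : `]a - d, a + d[%classic x -> D u -> `|partial1of2 tilt x u| <= G u.
  by move=> /Inorm xa _; rewrite partial1of2_tilt moment_tilt_le.
apply: DeriveDef; first exact: (derivable_under_integral mD Ia intf df G_ge0 intG G_ub).
rewrite -derive1E (differentiation_under_integral mD Ia intf df G_ge0 intG G_ub).
by apply: eq_Rintegral => u _; rewrite partial1of2_tilt.
Qed.

(* Jensen's inequality for the tilted law, whose mean is the logarithmic
   derivative [m] of [laplace] at [s]. *)
Lemma laplace_tangent s t : open finite_at -> finite_at s -> finite_at t ->
  0 < laplace s ->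
  laplace s * expR ((\int[mu]_(u in D) (u * tilt s u)) / laplace s * (t - s))
    <= laplace t.
Proof.
move=> oN Ns Nt s0; set Z' := \int[mu]_(u in D) _; set m := Z' / _.
have i0 := integrable_tilt Ns; have i1 := integrable_moment_tilt oN Ns.
pose c := expR (m * (t - s)).
(* [f u] is [tilt s u * c * (1 + (u - m) * (t - s))], from the tangent line of the exponential at
   [u = m]. The term in [u - m] integrates to 0 because [m] is the tilted mean, which leaves
   [laplace s * c]. *)
pose f u := (c * (1 - m * (t - s))) * tilt s u + (c * (t - s)) * (u * tilt s u).
have j0 := integrableZl mD (c * (1 - m * (t - s))) i0.
have j1 := integrableZl mD (c * (t - s)) i1.
have jf : mu.-integrable D (EFin \o f) by exact: (integrableD mD j0 j1).
have -> : laplace s * c = \int[mu]_(u in D) f u.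
  rewrite RintegralD// RintegralZl// RintegralZl// -/(laplace s) -/Z'.
  have -> : Z' = m * laplace s by rewrite /m mulfVK ?gt_eqF.
  by ring.
apply: le_Rintegral => //; first exact: integrable_tilt.
move=> u Du; rewrite /f /tilt.
have -> : u * t = u * s + m * (t - s) + (u - m) * (t - s) by ring.
rewrite !expRD -/c.
have := expR_ge1Dx ((u - m) * (t - s)).
rewrite -(ler_pM2l (expR_gt0 (m * (t - s)))) -/c.
move=> /(ler_wpM2l (expR_ge0 (u * s))) /(ler_wpM2l (h_ge0 Du)).
by move=> le_fu; lra.
Qed.

End laplace_transform.

(** * The log-partition function and its derivative *)

Section expfam_partition.
Variables (R : realType) (E : expfam R).
Notation mu := (ref_measure E).
Notation D := (response E).
Notation h := (base E).
Notation Z := (laplace mu D h).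
Notation N := (natural_space E).

Let mD : measurable D := @measurable_response R E.
Let mh : measurable_fun D h := @measurable_base R E.
Let h0 : forall u, D u -> 0 <= h u := @base_ge0 R E.

Lemma natural_spaceE : N = finite_at mu D h.
Proof.
apply/seteqP; split => t; rewrite /natural_space /finite_at /log_partition /= /tilt.
  by case: (integral _ _ _) => [r| |] //= _; rewrite ltry.
case: (integral _ _ _) => //= r _; first by case: ifP => //; rewrite ltry.
Qed.

(* Valid at every [t]: the junk values of [A] and [ln \o laplace] agree. *)
Lemma A_laplace (t : R) : A E t = ln (Z t).
Proof.
rewrite /A /log_partition /laplace /Rintegral /tilt.
case: (integral _ _ _) => [r| |] /=; [|by rewrite ln0..].
by case: ifP => // r0; rewrite ln0.
Qed.

(** On [B] the factor [expR (u * t)] is at least its value at [y], and the integral over the rest is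
    nonnegative. *)
Lemma base_mass_tilt_le (B : set (measurableTypeR R)) (y t : R) :
  measurable B -> (forall u, B u -> y * t <= u * t) ->
  (base_mass E B * (expR (y * t))%:E <= \int[mu]_(u in D) (tilt h t u)%:E)%E.
Proof.
move=> mB Bt; have mDB : measurable (D `&` B) by exact: measurableI.
have sub : D `&` B `<=` D by exact: subIsetl.
have mDBh : measurable_fun (D `&` B) h by exact: measurable_funS mh.
have mt := measurable_tilt mh t.
apply: (@le_trans _ _ (\int[mu]_(u in D `&` B) (tilt h t u)%:E)%E); last first.
  apply: ge0_subset_integral => //; first exact/measurable_EFinP.
  by move=> u Du; rewrite lee_fin (tilt_ge0 h0).
rewrite /base_mass -ge0_integralZr//; last first.
- by move=> u [Du _]; rewrite lee_fin h0.
- exact/measurable_EFinP.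
apply: ge0_le_integral => //.
- by move=> u [Du _]; rewrite -EFinM lee_fin mulr_ge0 ?h0 ?expR_ge0.
- apply/measurable_EFinP; exact: measurable_funM.
- by apply/measurable_EFinP; exact: measurable_funS mt.
- by move=> u [Du Bu]; rewrite -EFinM lee_fin ler_wpM2l ?h0// ler_expR Bt.
Qed.

Lemma base_mass_ge0 B : (0 <= base_mass E B)%E.
Proof. by apply: integral_ge0 => u [Du _]; rewrite lee_fin h0. Qed.

(** [u * t] is at least [y * t] to the right of [y] if [t >= 0] and to the left if [t < 0]; both
    sides carry mass as [y] is no endpoint. For the counting measure the atom at [y] serves every
    [t]. *)
Lemma tilt_lower_bound (y : R) : supp E y ->
  (dom E = Lebesgue -> ~ support_endpoint E y) ->
  exists2 c : R, 0 < c & forall t, N t -> c * expR (y * t) <= Z t.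
Proof.
move=> ys yend.
(* [B] may vary with [t], while [c] must bound its mass below uniformly. *)
suff [c c0 H] : exists2 c : R, 0 < c & forall t,
    exists B : set (measurableTypeR R), [/\ measurable B,
    (forall u : R, B u -> y * t <= u * t) & (c%:E <= base_mass E B)%E].
  exists c => // t; rewrite natural_spaceE => Nt.
  have [B [mB Bt cB]] := H t.
  rewrite -lee_fin -(laplaceE mD mh h0 Nt) (le_trans _ (base_mass_tilt_le mB Bt))//.
  by rewrite EFinM lee_wpmul2r// lee_fin expR_ge0.
(* A base mass can be infinite, so a positive real below it is extracted. *)
have pos_real (b : \bar R) : (0 < b)%E -> exists2 r : R, 0 < r & (r%:E <= b)%E.
  case: b => [r| |]//; first by rewrite lte_fin; exists r.
  by exists 1; rewrite ?leey.
move: ys yend; rewrite /supp; case Ed: (dom E).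
  move=> _ /(_ erefl) yend.
  have [bl br] : (0 < base_mass E `]-oo, y[)%E /\ (0 < base_mass E `]y, +oo[)%E.
    rewrite !lt0e !base_mass_ge0 !andbT.
    by split; apply/eqP => b0; apply: yend; [left|right].
  have [l l0 lb] := pos_real _ bl; have [r r0 rb] := pos_real _ br.
  exists (Num.min l r) => [|t]; first by rewrite lt_min l0.
  have [t0|t0] := leP 0 t.
    exists `]y, +oo[%classic; split => //.
      by move=> u; rewrite /= in_itv/= andbT => /ltW yu; rewrite ler_wpM2r.
    by rewrite (le_trans _ rb)// lee_fin ge_min lexx orbT.
  exists `]-oo, y[%classic; split => //.
    by move=> u; rewrite /= in_itv/= => /ltW yu; rewrite ler_wnM2r// ltW.
  by rewrite (le_trans _ lb)// lee_fin ge_min lexx.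
move=> [Dy hy] _; exists (h y) => // t; exists [set y]; split => //.
  by move=> u ->.
rewrite /base_mass setIidr; last by move=> u ->.
rewrite (eq_integral (cst (h y)%:E)); last by move=> u /set_mem ->.
rewrite integral_cst// /ref_measure Ed /= /counting.
rewrite asboolT; last exact: finite_set1.
by rewrite fset_set1 finmap.cardfs1 mule1.
Qed.

(** The logarithm of the lower bound on [Z]: the convex conjugate of [A] is finite at [y]. *)
Lemma A_upper_bound (y : R) : supp E y ->
  (dom E = Lebesgue -> ~ support_endpoint E y) ->
  exists K : R, forall t, N t -> y * t - A E t <= K.
Proof.
move=> ys yend; have [c c0 H] := tilt_lower_bound ys yend.
exists (- ln c) => t /H ct; rewrite A_laplace.
have : ln (c * expR (y * t)) <= ln (Z t).
  have cy0 : 0 < c * expR (y * t) by rewrite mulr_gt0 ?expR_gt0.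
  by rewrite ler_ln// posrE (lt_le_trans cy0).
by rewrite lnM ?posrE ?expR_gt0// expRK; lra.
Qed.

Hypothesis oN : open N.
Hypothesis Z_gt0 : forall t, N t -> 0 < Z t.

Let oZ : open (finite_at mu D h). Proof. by rewrite -natural_spaceE. Qed.

Lemma is_derive_A (t : R) : N t ->
  is_derive t (1 : R) (A E) (\int[mu]_(u in D) (u * tilt h t u) / Z t).
Proof.
move=> Nt; have -> : A E = (fun s => ln (Z s)) by apply/funext => s; exact: A_laplace.
have dZ : is_derive t (1 : R) Z (\int[mu]_(u in D) (u * tilt h t u)).
  by apply: is_derive_laplace => //; rewrite -natural_spaceE.
have dln := is_derive1_ln (Z_gt0 Nt).
by have := is_derive1_comp dln dZ; rewrite mulrC.
Qed.

(** In logarithms, [laplace_tangent] puts [A] above each of its tangents; adding those at [s] and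
    [t] orders the slopes. *)
Lemma derive1_A_nondecreasing (s t : R) : N s -> N t -> s < t ->
  derive1 (A E) s <= derive1 (A E) t.
Proof.
move=> Ns Nt st.
have tangent a b : N a -> N b -> derive1 (A E) a * (b - a) <= A E b - A E a.
  move=> Na Nb; have dA := is_derive_A Na.
  rewrite derive1E derive_val !A_laplace.
  move: (Na) (Nb); rewrite natural_spaceE => Na' Nb'.
  have := laplace_tangent mD mh h0 oZ Na' Nb' (Z_gt0 Na).
  rewrite -ler_ln ?posrE ?mulr_gt0 ?expR_gt0 ?Z_gt0//.
  by rewrite lnM ?posrE ?expR_gt0 ?Z_gt0// expRK -lerBrDl.
have slopes (a b x y : R) : a * (t - s) <= y - x -> b * (s - t) <= x - y -> a <= b.
  by move=> le_a le_b; rewrite -(@ler_pM2r _ (t - s)) ?subr_gt0//; lra.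
exact: slopes (tangent _ _ Ns Nt) (tangent _ _ Nt Ns).
Qed.

Lemma continuous_A : {in N, continuous (A E)}.
Proof.
move=> t /set_mem /is_derive_A[/derivable1_diffP].
by move=> /differentiable_continuous.
Qed.

End expfam_partition.

(** * Gaussian tails and differences of logarithms *)

Section gaussian_tail.
Variable R : realType.
Notation leb := (@lebesgue_measure R).
Implicit Types x M : R.

Lemma phi1E x : phi1 x = normal_peak 1 * expR (- (1 / 2) * x ^+ 2).
Proof.
rewrite /phi1 normal_pdfE ?oner_neq0// /normal_fun subr0 expr1n.
by congr (_ * expR _); lra.
Qed.

Lemma phi1_gt0 x : 0 < phi1 x.
Proof. by rewrite phi1E mulr_gt0 ?expR_gt0 ?normal_peak_gt0. Qed.

Lemma continuous_phi1 : continuous (@phi1 R).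
Proof. by apply: continuous_normal_pdf; rewrite oner_neq0. Qed.

Lemma measurable_phi1 : measurable_fun [set: R] (@phi1 R).
Proof. exact: measurable_normal_pdf. Qed.

Lemma is_derive_phi1 x : is_derive x (1 : R) (@phi1 R) (- (x * phi1 x)).
Proof.
have -> : @phi1 R = fun y => normal_peak 1 * expR (- (1 / 2) * y ^+ 2).
  by apply/funext => y; exact: phi1E.
by apply: is_derive_eq; rewrite /GRing.scale/=; field.
Qed.

Lemma cvgy_phi1 : @phi1 R x @[x --> +oo] --> (0 : R).
Proof.
apply: (@squeeze_cvgr _ _ _ _ (cst 0)
  (fun x => normal_peak 1 * expR (1 / 2) * expR (- x))).
- near=> x; rewrite (ltW (phi1_gt0 _)) phi1E -mulrA ler_wpM2l ?normal_peak_ge0//.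
  (* [(x - 1) ^+ 2 >= 0] gives [- x ^+ 2 / 2 <= 1 / 2 - x]. *)
  rewrite -expRD ler_expR; have := sqr_ge0 (x - 1); rewrite sqrrB1; lra.
- exact: cvg_cst.
- rewrite -[X in _ --> X](mulr0 (normal_peak 1 * expR (1 / 2))).
  by apply: cvgM; [exact: cvg_cst|exact: cvgr_expR].
Unshelve. all: by end_near. Qed.

(** [- phi1] is an antiderivative that vanishes at infinity. *)
Lemma integral_id_phi1 M : 0 <= M ->
  (\int[leb]_(x in `[M, +oo[) (x * phi1 x)%:E = (phi1 M)%:E)%E.
Proof.
move=> M0; rewrite (@ge0_continuous_FTC2y _ _ (fun x => - phi1 x) M 0).
- by rewrite EFinN oppeK add0e.
- by move=> x Mx; rewrite mulr_ge0 ?(ltW (phi1_gt0 _))// (le_trans M0).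
- apply: continuous_subspaceT => x.
  by apply: cvgM; [exact: cvg_id|exact: continuous_phi1].
- by rewrite -oppr0; apply: cvgN; exact: cvgy_phi1.
- by move=> x _; apply: derivableN; have [] := is_derive_phi1 x.
- by apply: cvgN; apply: cvg_at_right_filter; exact: continuous_phi1.
- move=> x _; have := is_deriveN (is_derive_phi1 x) => dx.
  by rewrite derive1E derive_val opprK.
Qed.

(** On [[M, +oo[] the factor [x / M] is at least 1, and inserting it makes the integral explicit. *)
Lemma mills_upper_bound M : 0 < M ->
  (\int[leb]_(x in `[M, +oo[) (phi1 x)%:E <= (phi1 M / M)%:E)%E.
Proof.
move=> M0; rewrite mulrC EFinM -(integral_id_phi1 (ltW M0)).
have mp := measurable_funTS measurable_phi1.
rewrite -ge0_integralZl_EFin//; last 3 first.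
- move=> x; rewrite /= in_itv/= andbT => Mx.
  by rewrite lee_fin mulr_ge0 ?(ltW (phi1_gt0 _))// (le_trans (ltW M0)).
- by apply/measurable_EFinP; apply: measurable_funM => //; exact: mp.
- by rewrite invr_ge0 ltW.
apply: ge0_le_integral => //.
- by move=> x _; rewrite lee_fin ltW// phi1_gt0.
- by apply/measurable_EFinP; exact: mp.
- by apply/measurable_EFinP; do 2 (apply: measurable_funM => //); exact: mp.
- move=> x; rewrite /= in_itv/= andbT => Mx; rewrite -EFinM lee_fin mulrA.
  by rewrite ler_peMl ?(ltW (phi1_gt0 _))// mulrC ler_pdivlMr// mul1r.
Qed.

Lemma phi1N x : phi1 (- x) = phi1 x.
Proof. by rewrite !phi1E sqrrN. Qed.

Lemma phi1_tail M : 0 < M ->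
  (\int[leb]_(x in ~` `[(- M)%R, M]) (phi1 x)%:E <= (2 * (phi1 M / M))%:E)%E.
Proof.
move=> M0; have mp := measurable_funTS measurable_phi1.
apply: (@le_trans _ _
  (\int[leb]_(x in `]-oo, (- M)%R] `|` `[M, +oo[) (phi1 x)%:E)%E).
  apply: ge0_subset_integral => //.
  - exact: measurableC.
  - exact: measurableU.
  - by apply/measurable_EFinP; exact: mp.
  - by move=> x _; rewrite lee_fin ltW// phi1_gt0.
  - move=> x /=; rewrite !in_itv/= andbT => /negP.
    by rewrite negb_and -!ltNge => /orP[|] /ltW ->; [left|right].
rewrite ge0_integral_setU//; last 3 first.
- by apply/measurable_EFinP; exact: mp.
- by move=> x _; rewrite lee_fin ltW// phi1_gt0.
- rewrite disj_set2E; apply/eqP/seteqP; split => // x /=.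
  by rewrite !in_itv/= andbT => -[? ?]; lra.
rewrite mulr_natl mulr2n EFinD; apply: leeD; last exact: mills_upper_bound.
(* The reflection in 0 turns the left tail into the right one. *)
rewrite ge0_integration_by_substitutionNy//; last 2 first.
- by apply: continuous_subspaceT; exact: continuous_phi1.
- by move=> x _; rewrite ltW// phi1_gt0.
under eq_integral do rewrite /= phi1N.
exact: mills_upper_bound.
Qed.

(** [ln (1 + b / a) <= b / a <= b / c]; with [c] in place of [a] the final constant can be free of
    [M]. *)
Lemma lne_ratio_le (a b : \bar R) (c : R) : 0 < c ->
  (c%:E <= a)%E -> a \is a fin_num -> (0 <= b)%E -> b \is a fin_num ->
  (0 <= lne (a + b) - lne a <= (c^-1)%:E * b)%E.
Proof.
move=> c0; case: a => [a| |]//; case: b => [b| |]//; rewrite !lee_fin => ca _ b0 _.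
have a0 : 0 < a by exact: lt_le_trans ca.
rewrite -EFinD !lne_EFin ?ltr_wpDr// -EFinB -EFinM !lee_fin subr_ge0.
rewrite ler_ln ?posrE ?ltr_wpDr// lerDl b0/= -ln_div ?posrE ?ltr_wpDr//.
rewrite mulrDl mulfV ?gt_eqF// (le_trans (le_ln1Dx _))//.
  by rewrite (lt_le_trans (ltrN10 _))// divr_ge0// ltW.
by rewrite mulrC ler_wpM2r// lef_pV2.
Qed.

End gaussian_tail.

(** * Monotonicity and measurability of the natural parameter *)

Section natural_parameter.
Variables (R : realType) (E : expfam R) (eta : R -> R).
Hypothesis heta : link_function E eta.
Notation N := (natural_space E).

(** [eta] is onto, so the partial inverse never falls back on its default 0. *)
Lemma link_inv_mean (s : R) : mean_space E (link_inv E eta s).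
Proof.
case: heta => _ _ surj_eta.
by apply: (surjpinv_image_sub surj_eta); exists s.
Qed.

Lemma link_invK (s : R) : eta (link_inv E eta s) = s.
Proof.
case: heta => _ _ surj_eta.
by apply: (surjpK (fun=> 0) surj_eta); rewrite inE.
Qed.

Lemma A'_inv_natural (m : R) : mean_space E m -> N (A'_inv E m).
Proof.
move=> Mm; have surj_A' : set_surj N (mean_space E) (derive1 (A E)) by [].
by apply: (surjpinv_image_sub surj_A'); exists m.
Qed.

Lemma A'_invK (m : R) : mean_space E m -> derive1 (A E) (A'_inv E m) = m.
Proof.
by move=> Mm; apply: (@pinvK _ _ (fun=> 0) N (derive1 (A E))); rewrite inE.
Qed.

(** The argument is the linear predictor; [vartheta i] unfolds to this function at a predictor
    affine in [xi]. *)
Definition natural_param (s : R) : R := A'_inv E (link_inv E eta s).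

Lemma natural_param_natural s : N (natural_param s).
Proof. exact/A'_inv_natural/link_inv_mean. Qed.

Hypothesis A'_nd : forall s t : R, N s -> N t -> s < t ->
  derive1 (A E) s <= derive1 (A E) t.

(** If the inverse reversed the order, monotonicity of [derive1 (A E)] would give [m' <= m]. *)
Lemma A'_inv_le (m m' : R) : mean_space E m -> mean_space E m' -> m < m' ->
  A'_inv E m <= A'_inv E m'.
Proof.
move=> Mm Mm' mm'; rewrite leNgt; apply/negP => lt'.
have := A'_nd (A'_inv_natural Mm') (A'_inv_natural Mm) lt'.
by rewrite !A'_invK// leNgt mm'.
Qed.

Lemma natural_param_monotone :
  nondecreasing_fun natural_param \/ nonincreasing_fun natural_param.
Proof.
case: (heta) => _ [inc|dec] _; [left|right] => s t; rewrite /natural_param;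
  rewrite le_eqVlt => /predU1P[->//|st].
  apply: A'_inv_le; try exact: link_inv_mean.
  (* A reversed order contradicts the monotone link, and equality contradicts [link_invK]. *)
  case: ltgtP => // [lt'|eq'].
    have := inc _ _ (mem_set (link_inv_mean t)) (mem_set (link_inv_mean s)) lt'.
    by rewrite !link_invK ltNge (ltW st).
  by move: st; rewrite -(link_invK s) eq' link_invK ltxx.
apply: A'_inv_le; try exact: link_inv_mean.
case: ltgtP => // [lt'|eq'].
  have := dec _ _ (mem_set (link_inv_mean t)) (mem_set (link_inv_mean s)) lt'.
  by rewrite !link_invK ltNge (ltW st).
by move: st; rewrite -(link_invK s) -eq' link_invK ltxx.
Qed.

Lemma measurable_natural_param (c r : R) : 0 <= r ->
  measurable_fun [set: R] (fun xi => natural_param (c + r * xi)).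
Proof.
move=> r0; have [nd|ni] := natural_param_monotone.
  apply: nondecreasing_measurable => // s t st.
  by apply: nd; rewrite lerD2l ler_wpM2l.
apply: nonincreasing_measurable => // s t st.
by apply: ni; rewrite lerD2l ler_wpM2l.
Qed.

End natural_parameter.

(** * Truncating the integral of a positive function dominated by a Gaussian *)

Section truncation.
Variable R : realType.
Notation leb := (@lebesgue_measure R).
Variables (F : R -> R) (K : R).
Hypothesis mF : measurable_fun [set: R] F.
Hypothesis F_gt0 : forall x, 0 < F x.
Hypothesis F_le : forall x, F x <= K * phi1 x.

Let F_ge0 x : (0 <= (F x)%:E)%E. Proof. by rewrite lee_fin ltW. Qed.

Let mFD (D : set (measurableTypeR R)) : measurable_fun D (EFin \o F).
Proof. by apply/measurable_EFinP; exact: measurable_funTS. Qed.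

Let K_gt0 : 0 < K.
Proof. by have := lt_le_trans (F_gt0 0) (F_le 0); rewrite pmulr_lgt0// phi1_gt0. Qed.

(** [F] vanishes nowhere, so a zero integral would put an interval of length 2 inside a null set. *)
Lemma integral_itv_gt0 : (0 < \int[leb]_(x in `[(- 1)%R, 1%R]) (F x)%:E)%E.
Proof.
rewrite lt0e integral_ge0 ?andbT//; apply/eqP => int0.
have [+ _] := @ae_eq_integral_abs _ (measurableTypeR R) R leb `[(- 1)%R, 1%R]%classic
  (measurable_itv _) (EFin \o F) (@mFD _).
rewrite -[X in _ = X -> _]int0; case.
  by apply: eq_integral => x _; rewrite /= ger0_norm// ltW.
move=> Z [mZ Z0 sub].
have : (leb (`[(- 1)%R, 1%R]%classic : set R) <= leb Z)%E.
  apply: le_measure; rewrite ?inE// => x xI; apply: sub => /(_ xI) /= /eqP.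
  by rewrite eqe gt_eqF.
rewrite Z0 lebesgue_measure_itv/= lte_fin ifT; last by lra.
by rewrite -EFinB lee_fin; lra.
Qed.

Lemma integral_le_phi1 (D : set R) : measurable D ->
  (\int[leb]_(x in D) (F x)%:E <= K%:E * \int[leb]_(x in D) (phi1 x)%:E)%E.
Proof.
move=> mD; have mp : measurable_fun D (EFin \o @phi1 R).
  by apply/measurable_EFinP; exact: (measurable_funTS (@measurable_phi1 R)).
have p0 x : (0 <= (phi1 x : R)%:E)%E by rewrite lee_fin ltW// phi1_gt0.
rewrite -ge0_integralZl_EFin//; last exact: ltW.
apply: ge0_le_integral => //.
- exact: measurable_funeM.
- by move=> x _; rewrite -EFinM lee_fin.
Qed.

Lemma truncation_error : exists2 C : R, 0 < C & forall M, 1 <= M ->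
  (0 <= lne (\int[leb]_x (F x)%:E) - lne (\int[leb]_(x in `[(- M)%R, M]) (F x)%:E)
     <= (C * (1 / M) * expR (- (1 / 2) * M ^+ 2))%:E)%E.
Proof.
have total_lty (D : set R) : measurable D -> (\int[leb]_(x in D) (F x)%:E < +oo)%E.
  move=> mD; apply: (@le_lt_trans _ _ (\int[leb]_x (F x)%:E)%E).
    by apply: ge0_subset_integral => //; exact: mFD.
  apply: le_lt_trans (integral_le_phi1 measurableT) _.
  by rewrite /phi1 integral_normal_pdf mule1 ltry.
have fin (D : set R) : measurable D -> (\int[leb]_(x in D) (F x)%:E)%E \is a fin_num.
  by move=> mD; rewrite ge0_fin_numE ?total_lty// integral_ge0.
have mI (M : R) : measurable (`[(- M)%R, M]%classic : set R) by [].
(* For [M >= 1] the truncated integral is at least that over [[-1, 1]]: a lower bound free of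
   [M]. *)
set c := fine (\int[leb]_(x in `[(- 1)%R, 1%R]) (F x)%:E)%E.
have cE : c%:E = (\int[leb]_(x in `[(- 1)%R, 1%R]) (F x)%:E)%E by rewrite fineK// fin.
have c0 : 0 < c by rewrite -lte_fin cE integral_itv_gt0.
(* [c^-1] makes the mass relative, [K] comes from the domination, 2 counts the tails and
   [normal_peak 1] normalises [phi1]. *)
exists (c^-1 * (K * (2 * normal_peak 1))).
  by rewrite mulr_gt0 ?invr_gt0// mulr_gt0// mulr_gt0// normal_peak_gt0.
move=> M M1; have M0 : 0 < M by rewrite (lt_le_trans ltr01).
have -> : (\int[leb]_x (F x)%:E = \int[leb]_(x in `[(- M)%R, M]) (F x)%:E
    + \int[leb]_(x in ~` `[(- M)%R, M]) (F x)%:E)%E.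
  rewrite -(setUv `[(- M)%R, M]%classic) ge0_integral_setU//.
  - exact: measurableC.
  - exact/disj_setPCl.
have mC : measurable (~` `[(- M)%R, M]%classic : set R) by exact: measurableC.
have cM : (c%:E <= \int[leb]_(x in `[(- M)%R, M]) (F x)%:E)%E.
  rewrite cE; apply: ge0_subset_integral => //.
  by move=> x; rewrite /= !in_itv/= => /andP[? ?]; apply/andP; split; lra.
have tail0 : (0 <= \int[leb]_(x in ~` `[(- M)%R, M]) (F x)%:E)%E.
  exact: integral_ge0.
have /andP[-> /= up] := lne_ratio_le c0 cM (fin _ (mI M)) tail0 (fin _ mC).
apply: (le_trans up).
have -> : c^-1 * (K * (2 * normal_peak 1)) * (1 / M) * expR (- (1 / 2) * M ^+ 2)
    = c^-1 * (K * (2 * (phi1 M / M))) by rewrite phi1E; ring.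
rewrite EFinM lee_wpmul2l ?lee_fin ?invr_ge0 ?(ltW c0)//.
apply: le_trans (integral_le_phi1 mC) _.
by rewrite [leRHS]EFinM lee_wpmul2l ?lee_fin ?(ltW K_gt0)// phi1_tail.
Qed.

End truncation.

(** * From the tail bound to the exponential rate *)

Section log_rate.
Variable R : realType.

Lemma limf_esup_log_rate (d : R -> \bar R) (M0 C : R) : 0 < M0 -> 0 < C ->
  (forall M, M0 <= M -> (d M <= (C * (1 / M) * expR (- (1 / 2) * M ^+ 2))%:E)%E) ->
  (limf_esup (fun M : R => (1 / M ^+ 2)%:E * lne (d M)) +oo%R <= (- (1 / 2))%:E)%E.
Proof.
move=> M00 C0 dM; apply/lee_addgt0Pr => e e0.
have [M1 [M1_1 M1_M0 M1_C]] : exists M1 : R, [/\ 1 <= M1, M0 <= M1 & ln C / e <= M1].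
  (* Beyond 1, [ln M >= 0] and [M <= M ^+ 2]; beyond [ln C / e], [ln C <= e * M], so the constant
     costs at most [e] after division by [M ^+ 2]. *)
  exists (Num.max 1 (Num.max M0 (ln C / e))).
  by rewrite !le_max !lexx !orbT.
(* The limit superior is an infimum of suprema over neighbourhoods of infinity; one ray is enough
   for an upper bound. *)
apply: (@le_trans _ _ (ereal_sup
    ((fun M : R => ((1 / M ^+ 2)%:E * lne (d M))%E) @` [set M | M1 <= M]))).
  apply: ereal_inf_lbound; exists [set M | M1 <= M] => //.
  by exists M1; split => [|M /ltW]; rewrite ?num_real.
apply: ge_ereal_sup => _ [M /= M1M <-].
have M1' : 1 <= M by exact: le_trans M1M.
have M_gt0 : 0 < M by exact: lt_le_trans M1'.
have M2_gt0 : 0 < M ^+ 2 by rewrite exprn_gt0.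
pose b := C * (1 / M) * expR (- (1 / 2) * M ^+ 2).
have b0 : 0 < b by rewrite !mulr_gt0 ?expR_gt0 ?invr_gt0.
have lned : (lne (d M) <= (ln b)%:E)%E.
  have := dM _ (le_trans M1_M0 M1M); rewrite -/b -lne_EFin//.
  (* Here the convention [log 0 = -oo] enters: [lne] is [-oo] at nonpositive arguments. *)
  have [d0|d0] := leP (d M) 0%E; first by rewrite le0_lneNy ?leNye.
  by rewrite lee_lne// in_itv/= leey andbT ?lee_fin ltW.
apply: (@le_trans _ _ ((1 / M ^+ 2)%:E * (ln b)%:E)%E).
  by rewrite lee_wpmul2l// lee_fin divr_ge0// ltW.
rewrite -EFinM -EFinD lee_fin mulrC mul1r ler_pdivrMr//.
rewrite /b !lnM ?posrE ?mulr_gt0 ?expR_gt0 ?invr_gt0// expRK ln1 add0r lnV ?posrE//.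
have lnM0 : 0 <= ln M by rewrite ln_ge0.
have lnC : ln C <= M * e by rewrite -ler_pdivrMr// (le_trans M1_C).
have : M * e <= e * M ^+ 2 by rewrite mulrC ler_pM2l// expr2 ler_peMl// ltW.
lra.
Qed.

End log_rate.

(** * The integrand of the marginal likelihood *)

Section integrand.
Variables (R : realType) (E : expfam R) (eta : R -> R).
Hypotheses (hE : regular E) (heta : link_function E eta).
Variables (n p q k : nat) (f : 'rV[R]_p -> R) (g : 'rV[R]_q -> 'rV[R]_k).
Variables (x : 'I_n -> 'rV[R]_p) (z : 'rV[R]_q) (y : 'I_n -> R).
Hypothesis n_gt0 : (1 <= n)%N.
Hypothesis hy : forall i, supp E (y i).
Hypothesis hend : dom E = Lebesgue -> forall i, ~ support_endpoint E (y i).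
Notation N := (natural_space E).

Let log_lik (xi : R) : R := \sum_(i < n)
  (y i * vartheta E eta f g x z i xi - A E (vartheta E eta f g x z i xi)).

Let yend i : dom E = Lebesgue -> ~ support_endpoint E (y i).
Proof. by move=> Ed; exact: hend. Qed.

Let oN : open N. Proof. by case: hE. Qed.

(** Since [n >= 1], there is a response at which [tilt_lower_bound] applies. *)
Let Z_gt0 (t : R) : N t -> 0 < laplace (ref_measure E) (response E) (base E) t.
Proof.
move=> Nt; have [c c0 H] := tilt_lower_bound (hy (Ordinal n_gt0)) (@yend (Ordinal n_gt0)).
by rewrite (lt_le_trans _ (H _ Nt))// mulr_gt0 ?expR_gt0.
Qed.

Let A_nd := derive1_A_nondecreasing oN Z_gt0.

Lemma measurable_log_lik : measurable_fun [set: R] log_lik.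
Proof.
apply: measurable_sum => i.
have mv : measurable_fun [set: R] (vartheta E eta f g x z i).
  by apply: (measurable_natural_param heta A_nd); exact: sqrtr_ge0.
apply: measurable_funB; first exact: measurable_funM.
(* Continuity of [A] is available on the open set [N], so the composition goes through [N], where
   [vartheta i] takes its values. *)
apply: (@measurable_comp _ _ _ _ _ _ N) => //.
- exact: open_measurable.
- by move=> _ [xi _ <-]; exact: natural_param_natural.
- by apply: open_continuous_measurable_fun => //; exact: continuous_A.
Qed.

Lemma log_lik_bounded : exists K, forall xi, log_lik xi <= K.
Proof.
have /choice [K HK] i := A_upper_bound (hy i) (@yend i).
exists (\sum_(i < n) K i) => xi; apply: ler_sum => i _; apply: HK.
exact: natural_param_natural.
Qed.

Lemma expR_L xi : expR (L E eta f g x z y xi) = expR (log_lik xi) * phi1 xi.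
Proof. by rewrite /L expRD lnK// posrE phi1_gt0. Qed.

Lemma Delta_bounds : exists2 C : R, 0 < C & forall M, 1 <= M ->
  (0 <= Delta E eta f g x z y M
     <= (C * (1 / M) * expR (- (1 / 2) * M ^+ 2))%:E)%E.
Proof.
have [K SK] := log_lik_bounded.
apply: (@truncation_error R (fun xi => expR (L E eta f g x z y xi)) (expR K)).
- under eq_fun do rewrite expR_L.
  apply: measurable_funM; last exact: measurable_phi1.
  exact: measurableT_comp measurable_log_lik.
- by move=> xi; exact: expR_gt0.
- by move=> xi; rewrite expR_L ler_wpM2r ?ler_expR// ltW// phi1_gt0.
Qed.

End integrand.

Theorem theorem3 (R : realType) (E : expfam R) (eta : R -> R)
    (hE : regular E) (heta : link_function E eta)
    (n p q k : nat) (hn : (1 <= n)%N)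
    (x : 'I_n -> 'rV[R]_p) (z : 'rV[R]_q)
    (Theta Psi : Type)
    (f : Theta -> 'rV[R]_p -> R) (g : Psi -> 'rV[R]_q -> 'rV[R]_k)
    (theta : Theta) (psi : Psi)
    (y : 'I_n -> R) (hy : forall i, supp E (y i))
    (hend : dom E = Lebesgue -> forall i, ~ support_endpoint E (y i)) :
  (exists M0 C : R, [/\ 0 < M0, 0 < C &
     forall M : R, M0 <= M ->
       (0 <= Delta E eta (f theta) (g psi) x z y M)%E /\
       (Delta E eta (f theta) (g psi) x z y M
          <= (C * (1 / M) * expR (- (1 / 2) * M ^+ 2))%:E)%E]) /\
  (limf_esup
     (fun M : R => (1 / M ^+ 2)%:E
                   * lne (Delta E eta (f theta) (g psi) x z y M))%E
     +oo%R <= (- (1 / 2))%:E)%E.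
Proof.
have [C C0 bounds] := Delta_bounds hE heta (f theta) (g psi) x z hn hy hend.
split.
  (* The threshold 1 serves all data; only [C] depends on them. *)
  by exists 1, C; split => // M /bounds /andP[].
by apply: (@limf_esup_log_rate R _ 1 C) => // M /bounds /andP[_].
Qed.
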